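(* Let $(x_1(T),x_2(T),\ldots)$, $T\ge 0$, denote the particle positions at time $T$ in slowed $t$-TASEP with parameter $t=e^{-\epsilon}$, $\epsilon>0$, and packed initial condition $x_k(0)=-k$ for all $k\geq 1$. Then for any $\tau>0$ and any $k\in\mathbb{Z}_{>0}$, $$\epsilon\cdot x_k(\tau/\epsilon)\;\longrightarrow\;\log\left(\sum_{j=0}^{k}\frac{\tau^j}{j!}\right)-\log\left(\sum_{j=0}^{k-1}\frac{\tau^j}{j!}\right)\qquad\text{in probability as }\epsilon\to 0^+.$$
   Context: Slowed $t$-TASEP with parameter $t\in(0,1)$ is the continuous-time Markov jump process on particle configurations $x_1>x_2>\cdots$ in $\mathbb{Z}$ ($x_k$ is the position of the $k$-th particle from the right) in which, when the current configuration is $(x_1,x_2,\ldots)$, the $k$-th particle jumps one unit to the right (independently of the other particles) at rate $t^{x_k+k}\left(1-t^{x_{k-1}-x_k-1}\right)$, for each $k\ge1$, with the convention $x_0=\infty$ (so the rate of the first particle is $t^{x_1+1}$). From the packed initial condition $x_k(0)=-k$, at every time one has $x_k=-k$ for all sufficiently large $k$, and the total jump rate always equals $1$. *)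

(* Defs.v *)
From HB Require Import structures.
From mathcomp Require Import all_boot all_order all_algebra.
From mathcomp Require Import all_classical all_reals all_analysis.
Import Order.TTheory GRing.Theory Num.Theory.
Import numFieldNormedType.Exports.

Set Implicit Arguments.
Unset Strict Implicit.
Unset Printing Implicit Defensive.

Local Open Scope classical_set_scope.
Local Open Scope ring_scope.

Record config := Config {
  config_pos : nat -> int ;
  config_decr : forall i, config_pos i.+1 < config_pos i }.

(* Particles are numbered from the right starting at 1, while [config_pos] is
   indexed from 0; [particle x 0] is a junk value, never used below. *)
Definition particle (x : config) (k : nat) : int := config_pos x k.-1.

Lemma packed_decr (i : nat) : - (i.+2)%:Z < - (i.+1)%:Z.
Proof. by rewrite ltrN2 ltz_nat. Qed.

Definition packed : config := Config packed_decr.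

Lemma particle_packed (k : nat) : (0 < k)%N -> particle packed k = - k%:Z.
Proof. by case: k. Qed.

(* The case k = 1 is the convention x_0 = +oo, i.e. t ^ x_0 = 0. *)
Definition particle_rate {R : realType} (t : R) (x : config) (k : nat) : R :=
  t ^ (particle x k + k%:Z) *
  (1 - (if k == 1%N then 0 else t ^ (particle x k.-1 - particle x k - 1))).

Definition particle_jump (x : config) (k : nat) (y : config) : Prop :=
  forall j : nat, (0 < j)%N -> particle y j = particle x j + (j == k)%:Z.

(* At most one k contributes. A blocked particle contributes to no
   [transition_rate t x y], since moving it would not give a [config]; its
   [particle_rate] is 0. *)
Definition transition_rate {R : realType} (t : R) (x y : config) : R :=
  fine (\esum_(k in [set k : nat | (0 < k)%N /\ particle_jump x k y])
          (particle_rate t x k)%:E).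

(* For t in (0, 1) the terms are nonnegative and, for every configuration
   reachable from [packed], the sum is finite and nonzero. *)
Definition total_rate {R : realType} (t : R) (x : config) : R :=
  fine (\esum_(k in [set k : nat | (0 < k)%N]) (particle_rate t x k)%:E).

(* Measurability for the product sigma-algebra on configurations, each
   coordinate being discrete. *)
Definition measurable_config {d} {Omega : measurableType d}
    (f : Omega -> config) : Prop :=
  forall (k : nat) (z : int), (0 < k)%N ->
    measurable [set w | particle (f w) k = z].

Definition jump_time {R : realType} {Omega : Type} (H : nat -> Omega -> R)
  (n : nat) (w : Omega) : R := \sum_(i < n) H i w.

(* Jump-chain / holding-time definition of the Markov jump process with rates
   [transition_rate t], started from [packed]: Y is the jump chain and H i is
   the time spent in Y i. Field [tasep_law] says that Y is a Markov chain with
   transition matrix transition_rate / total_rate and that, given Y, the H i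
   are independent, H i being exponential of parameter [total_rate t (Y i)].
   Only countably many paths of Y have positive probability, so this determines
   the joint law of (Y, H). *)
Record slowed_tasep_skeleton {R : realType} {d} {Omega : measurableType d}
    (t : R) (P : probability Omega R) (X : R -> Omega -> config)
    (Y : nat -> Omega -> config) (H : nat -> Omega -> R) : Prop := {
  tasep_measurable_chain : forall n, measurable_config (Y n) ;
  tasep_measurable_hold : forall n, measurable_fun setT (H n) ;
  tasep_hold_gt0 : forall n w, 0 < H n w ;
  tasep_law : forall (n : nat) (y : nat -> config) (s : nat -> R),
    (forall i, 0 <= s i) ->
    P [set w | (forall i, (i <= n)%N -> Y i w = y i) /\
               (forall i, (i < n)%N -> s i < H i w)] =
    (`[< y 0%N = packed >]%:R *
     \prod_(i < n) (transition_rate t (y i) (y i.+1) / total_rate t (y i) *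
                    expR (- (total_rate t (y i) * s i))))%:E ;
  tasep_path : forall (T : R) (n : nat) (w : Omega),
    jump_time H n w <= T < jump_time H n.+1 w -> X T w = Y n w }.

(* The value of X T w is unconstrained, except for measurability, on the event
   that infinitely many jumps occur by time T. *)
Definition slowed_tasep {R : realType} {d} {Omega : measurableType d}
    (t : R) (P : probability Omega R) (X : R -> Omega -> config) : Prop :=
  (forall T, 0 <= T -> measurable_config (X T)) /\
  exists (Y : nat -> Omega -> config) (H : nat -> Omega -> R),
    slowed_tasep_skeleton t P X Y H.

(* The variables Z i may live on different probability spaces. *)
Definition cvg_in_probability {R : realType} {I : Type} (F : set_system I)
    {d : I -> measure_display} {Omega : forall i, measurableType (d i)}
    (P : forall i, probability (Omega i) R) (Z : forall i, Omega i -> R)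
    (l : R) : Prop :=
  forall delta : R, 0 < delta ->
    (fun i => P i [set w | delta < `|Z i w - l|]) @ F --> 0%E.

(* Main.v *)
Require Import Defs.
From mathcomp Require Import all_boot all_order all_algebra.
From mathcomp Require Import all_classical all_reals all_analysis measurable_realfun.
From mathcomp Require Import zify ring lra.
Import Order.TTheory GRing.Theory Num.Theory.
Import numFieldNormedType.Exports.

(** With u_k = t ^ (x_k + k) and u_0 = 0, particle k jumps at rate u_k - u_(k-1)
    and its jump multiplies u_k by t, so the total rate is 1. Put
    v_k = 1 / (u_1 ... u_k) and a = 1 / t - 1. A jump of one of the first k
    particles, which has rate u_k, multiplies v_k by 1 + a; since
    v_k u_k = v_(k-1), one step of the jump chain sends the mean of v_k to
    E v_k + a E v_(k-1), hence after n steps E v_k = sum_(j <= k) C(n, j) a ^ j.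
    The same computation bounds E (v_k ^ 2) by the square of this sum with a
    replaced by b = a (1 + a). For n ~ tau / eps both sums tend to
    sum_(j <= k) tau ^ j / j!, so the variance vanishes and Chebyshev applies.
    The holding times are i.i.d. exponential of parameter 1, so about tau / eps
    jumps occur by time tau / eps; as v_k is nondecreasing along the chain, its
    value at that time is squeezed between its values after (tau -+ eta) / eps
    jumps. Finally eps x_k = ln v_k - ln v_(k-1) - eps k. *)

Set Implicit Arguments.
Unset Strict Implicit.
Unset Printing Implicit Defensive.

Local Open Scope classical_set_scope.
Local Open Scope ring_scope.

(** * Jumps and rates *)

Lemma config_ext (x y : config) :
  (forall i, config_pos x i = config_pos y i) -> x = y.
Proof.
case: x y => [f hf] [g hg] /= /funext fg; subst g.
by congr Config; exact: Prop_irrelevance.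
Qed.

(** Indices start from 0 here, as for [config_pos]: index [j] is the particle that [particle_rate]
    numbers [j.+1]. *)
Definition unblocked (x : config) (j : nat) : bool :=
  (j == 0)%N || (config_pos x j + 1 < config_pos x j.-1).

Lemma jump_decr (x : config) (j : nat) (i : nat) : unblocked x j ->
  config_pos x i.+1 + (i.+1 == j)%:Z < config_pos x i + (i == j)%:Z.
Proof.
move=> hj; have := config_decr x i; have [ij|ij] := eqVneq i.+1 j.
  move: hj; rewrite /unblocked -ij /= => hj _.
  have -> : (i == i.+1) = false by lia.
  by rewrite addr0.
by case: (i == j) => /= h; lia.
Qed.

(** Made total by leaving [x] fixed when the jump is blocked. Sums over all [j] stay correct, since
    a blocked particle has rate 0. *)
Definition jump (x : config) (j : nat) : config :=
  if pselect (unblocked x j) is left h then Config (fun i => jump_decr i h) else x.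

Lemma config_pos_jump (x : config) (j i : nat) : unblocked x j ->
  config_pos (jump x j) i = config_pos x i + (i == j)%:Z.
Proof. by move=> h; rewrite /jump; case: pselect. Qed.

Lemma jump_blocked (x : config) (j : nat) : ~~ unblocked x j -> jump x j = x.
Proof. by rewrite /jump; case: pselect => // h /negP[]. Qed.

Section Rates.
Variables (R : realType) (t : R).
Hypothesis t01 : 0 < t < 1.

Let t_gt0 : 0 < t. Proof. by case/andP: t01. Qed.
Let t_neq0 : t != 0. Proof. exact: lt0r_neq0. Qed.

Lemma exprz_nonincreasing (y z : int) : y <= z -> t ^ z <= t ^ y.
Proof.
move=> yz; rewrite -(subrK y z) expfzDr //.
apply: ler_piMl; first exact/exprz_ge0/ltW.
have -> : z - y = `|z - y|%N by lia.
by rewrite -exprnP exprn_ile1 ?ltW //; case/andP: t01.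
Qed.

(* [weight x k] is t ^ (x_k + k) for k >= 1; the value 0 at k = 0 encodes the
   convention x_0 = +oo, so that the k-th rate is [weight x k - weight x (k-1)]. *)
Definition weight (x : config) (k : nat) : R :=
  if k is j.+1 then t ^ (config_pos x j + j.+1%:Z) else 0.

#[global] Arguments weight x k : simpl never.

Lemma weight_gt0 x j : 0 < weight x j.+1.
Proof. exact: exprz_gt0. Qed.

(** The exponents x_k + k and x_(k-1) - x_k - 1 add up to x_(k-1) + (k - 1), so expanding the
    product gives a difference that telescopes in k. *)
Lemma particle_rateE x j :
  particle_rate t x j.+1 = weight x j.+1 - weight x j.
Proof.
rewrite /particle_rate /particle /weight /=; case: j => [|j] /=.
  by rewrite subr0 mulr1 subr0.
rewrite mulrBr mulr1 -expfzDr //; congr (_ - t ^ _); lia.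
Qed.

Lemma weight_nondecreasing x j : weight x j <= weight x j.+1.
Proof.
case: j => [|j]; first exact/ltW/weight_gt0.
by apply: exprz_nonincreasing; have := config_decr x j; lia.
Qed.

Lemma particle_rate_ge0 x j : 0 <= particle_rate t x j.+1.
Proof. by rewrite particle_rateE subr_ge0 weight_nondecreasing. Qed.

(** A blocked particle sits immediately to the left of its predecessor, so both have the same value
    of x_k + k and hence the same weight. *)
Lemma particle_rate_blocked x j :
  ~~ unblocked x j -> particle_rate t x j.+1 = 0.
Proof.
rewrite /unblocked negb_or particle_rateE => /andP[].
case: j => // j _ /= h; rewrite /weight; apply/eqP; rewrite subr_eq0; apply/eqP.
by congr (t ^ _); have := config_decr x j; lia.
Qed.

(** Finitary substitute for reachability: n jumps from [packed] lead to a configuration packed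
    beyond n. *)
Definition packed_beyond (m : nat) (x : config) : Prop :=
  forall i, (m <= i)%N -> config_pos x i = - i.+1%:Z.

Lemma packed_beyond_packed m : packed_beyond m packed.
Proof. by []. Qed.

(** In the packed region only the particle of index [m] can have a free site in front of it; every
    later one is blocked by its packed predecessor. *)
Lemma packed_beyond_jump m x j :
  packed_beyond m x -> packed_beyond m.+1 (jump x j).
Proof.
move=> hx; case: (boolP (unblocked x j)) => h i mi; last first.
  by rewrite jump_blocked // hx // ltnW.
rewrite config_pos_jump // hx; last exact: ltnW.
have [ij|] := eqVneq i j; last by rewrite addr0.
move: h; rewrite /unblocked; case: j ij => [|j] ij; first by lia.
by rewrite /= !hx; lia.
Qed.

Lemma weight_packed_beyond m x k : packed_beyond m x -> (m < k)%N ->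
  weight x k = 1.
Proof. by case: k => // k hx mk; rewrite /weight hx // addNr. Qed.

Lemma sum_particle_rate x (n : nat) :
  \sum_(0 <= j < n) particle_rate t x j.+1 = weight x n.
Proof.
under eq_bigr do rewrite particle_rateE.
by rewrite telescope_sumr // subr0.
Qed.

Lemma total_rate_packed_beyond m x : packed_beyond m x -> total_rate t x = 1.
Proof.
move=> hx; rewrite /total_rate.
have -> : [set k : nat | (0 < k)%N] = range succn.
  by apply/seteqP; split => [[|k]//= _|_ [k _ <-]//]; exists k.
rewrite esum_image; last by move=> i j _ _ [].
rewrite -nneseries_esumT; last by move=> j; rewrite lee_fin particle_rate_ge0.
(* The rates of index at least [m.+1] are differences of two weights equal to 1, and the first
   [m.+1] rates telescope to [weight x m.+1], which is 1. *)
rewrite (nneseries_split 0 m.+1); last first.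
  by move=> j _; rewrite lee_fin particle_rate_ge0.
rewrite eseries0 ?adde0; last first.
  move=> j mj _; rewrite particle_rateE !(weight_packed_beyond hx) ?subrr //; lia.
by rewrite sumEFin sum_particle_rate (weight_packed_beyond hx).
Qed.

Lemma particle_jumpP x j : unblocked x j -> particle_jump x j.+1 (jump x j).
Proof.
by move=> h [//|i] _; rewrite /particle /= config_pos_jump.
Qed.

Lemma transition_rate_jump x j : unblocked x j ->
  transition_rate t x (jump x j) = particle_rate t x j.+1.
Proof.
move=> h; rewrite /transition_rate.
(* Particle [j.+1] is displaced by 1, which determines the index of the jump. *)
have -> : [set k | (0 < k)%N /\ particle_jump x k (jump x j)] = [set j.+1].
  apply/seteqP; split => [k [k0 hk]|k ->] /=; last first.
    by split=> //; exact: particle_jumpP.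
  have := hk j.+1 erefl; rewrite /particle /= config_pos_jump // eqxx.
  by case: eqVneq => // _; lia.
by rewrite esum_set1 // lee_fin particle_rate_ge0.
Qed.

(* The inverse of the product of the first k weights: its one-step conditional
   expectation is linear in [path_weight x k] and [path_weight x (k-1)]. *)
Definition path_weight (x : config) (k : nat) : R :=
  \prod_(j < k) (weight x j.+1)^-1.

Lemma path_weight_gt0 x k : 0 < path_weight x k.
Proof. by apply: prodr_gt0 => j _; rewrite invr_gt0 weight_gt0. Qed.

Lemma path_weightS x k :
  path_weight x k.+1 * weight x k.+1 = path_weight x k.
Proof.
by rewrite /path_weight big_ord_recr /= mulfVK // lt0r_neq0 ?weight_gt0.
Qed.

Lemma weight_jump x j i : unblocked x j ->
  weight (jump x j) i.+1 = (if i == j then t else 1) * weight x i.+1.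
Proof.
move=> h; rewrite /weight config_pos_jump //; case: eqVneq => ij.
  by rewrite -[t in RHS]expr1z -expfzDr //; congr (t ^ _); lia.
by rewrite mul1r addr0.
Qed.

Lemma path_weight_jump x j k : unblocked x j ->
  path_weight (jump x j) k = (if (j < k)%N then t^-1 else 1) * path_weight x k.
Proof.
move=> h; rewrite /path_weight; elim: k => [|k IH].
  by rewrite !big_ord0 mulr1.
rewrite !big_ord_recr /= IH weight_jump //.
rewrite [(j < k.+1)%N]ltnS [(j <= k)%N]leq_eqVlt (eq_sym j).
have [->|kj] := eqVneq k j; last by rewrite /= mul1r; ring.
by rewrite ltnn /= invfM; ring.
Qed.


(** The convention u_0 = 0 covers k = 0, which gives the moment recurrences one form for all k. *)
Lemma path_weight_pred x k :
  path_weight x k * weight x k = if k is k'.+1 then path_weight x k' else 0.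
Proof. by case: k => [|k]; rewrite ?path_weightS // /weight mulr0. Qed.

Lemma path_weight_packed k : path_weight packed k = 1.
Proof.
by apply: big1 => j _; rewrite (weight_packed_beyond (@packed_beyond_packed 0)) ?invr1.
Qed.

(** * Moments of the jump chain *)

Section Iteration.
Variable N : nat.

(* The [n]-step transition operator of the jump chain; restricting to the first
   [N] particles loses nothing as long as the others have not left the packed
   region. *)
Fixpoint steps (n : nat) (f : config -> R) (x : config) : R :=
  if n is n'.+1 then
    \sum_(0 <= j < N) particle_rate t x j.+1 * steps n' f (jump x j)
  else f x.

(** The definition peels off the first jump, whereas the moment recurrences need the last one. *)
Lemma stepsSr n f x : steps n.+1 f x = steps n (steps 1 f) x.
Proof.
elim: n x => [//|n IH] x.
rewrite [LHS]/= [RHS]/=; apply: eq_bigr => j _.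
by congr (_ * _); exact: IH.
Qed.

(** Rates are nonnegative, so the operator is monotone. Comparing [f] and [g] where n jumps can lead
    suffices, and there the one-step formulas hold. *)
Lemma le_steps n m f g x : packed_beyond m x ->
  (forall y, packed_beyond (m + n) y -> f y <= g y) ->
  steps n f x <= steps n g x.
Proof.
elim: n m x => [|n IH] m x hx fg /=; first by apply: fg; rewrite addn0.
apply: ler_sum => j _; apply: ler_wpM2l; first exact: particle_rate_ge0.
apply: (IH m.+1); first exact: packed_beyond_jump.
by move=> y; rewrite addSnnS; exact: fg.
Qed.

Lemma eq_steps n m f g x : packed_beyond m x ->
  (forall y, packed_beyond (m + n) y -> f y = g y) ->
  steps n f x = steps n g x.
Proof.
move=> hx fg; apply/eqP; rewrite eq_le.
by apply/andP; split; apply: (le_steps hx) => y /fg ->.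
Qed.

Lemma stepsD n f g x :
  steps n (fun y => f y + g y) x = steps n f x + steps n g x.
Proof.
elim: n x => [//|n IH] x /=; rewrite -big_split /=.
by apply: eq_bigr => j _; rewrite IH mulrDr.
Qed.

Lemma stepsZ n c f x : steps n (fun y => c * f y) x = c * steps n f x.
Proof.
elim: n x => [//|n IH] x /=; rewrite big_distrr /=.
by apply: eq_bigr => j _; rewrite IH mulrCA.
Qed.

(** The bound on [m + n] keeps all particles of positive rate among the first [N] at each step, so
    the truncated rates still sum to 1. *)
Lemma steps_cst n m c x : packed_beyond m x -> (m + n <= N)%N ->
  steps n (fun=> c) x = c.
Proof.
elim: n m x => [//|n IH] m x hx mN /=.
under eq_bigr => j _.
  rewrite (IH m.+1); [over|exact: packed_beyond_jump|by rewrite addSnnS].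
rewrite -big_distrl /= sum_particle_rate (weight_packed_beyond hx) ?mul1r //.
by apply: leq_trans mN; rewrite addnS ltnS leq_addr.
Qed.

Lemma sum_particle_rate_lt x k : (k <= N)%N ->
  \sum_(0 <= j < N) particle_rate t x j.+1 * (j < k)%:R = weight x k.
Proof.
move=> kN; rewrite -sum_particle_rate (big_nat_widen 0 k N) //= [RHS]big_mkcond /=.
by apply: eq_bigr => j _; case: (j < k)%N; rewrite ?mulr1 ?mulr0.
Qed.

Let a := t^-1 - 1.
Let b := a * (1 + a).

Let a_ge0 : 0 <= a.
Proof. by rewrite subr_ge0 invf_ge1 // ltW //; case/andP: t01. Qed.

(** The factor [particle_rate] removes the case distinction on blocked jumps, for which both sides
    vanish. *)
Let rate_path_weight_jump x j k :
  particle_rate t x j.+1 * path_weight (jump x j) k =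
  particle_rate t x j.+1 * ((1 + a * (j < k)%:R) * path_weight x k).
Proof.
case: (boolP (unblocked x j)) => h; last by rewrite particle_rate_blocked // !mul0r.
rewrite path_weight_jump //; congr (_ * (_ * _)).
by case: (j < k)%N; rewrite ?mulr1 ?mulr0 ?addr0 // /a addrC subrK.
Qed.

Lemma step_path_weight m x k : packed_beyond m x -> (m < N)%N -> (k <= N)%N ->
  steps 1 (path_weight^~ k) x =
  path_weight x k + a * (if k is k'.+1 then path_weight x k' else 0).
Proof.
move=> hx mN kN /=.
rewrite (eq_bigr (fun j => path_weight x k * particle_rate t x j.+1 +
   (a * path_weight x k) * (particle_rate t x j.+1 * (j < k)%:R))); last first.
  by move=> j _; rewrite rate_path_weight_jump; ring.
rewrite big_split /= -!big_distrr /= sum_particle_rate sum_particle_rate_lt //.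
by rewrite (weight_packed_beyond hx mN) mulr1 -mulrA path_weight_pred.
Qed.

(* Only an inequality, but symmetric in k and l and closed under iteration, and
   sharp enough because b / a -> 1 as t -> 1. *)
Lemma step_path_weightM m x k l :
  packed_beyond m x -> (m < N)%N -> (k <= N)%N -> (l <= N)%N ->
  steps 1 (fun y => path_weight y k * path_weight y l) x <=
  path_weight x k * path_weight x l +
  b * ((if k is k'.+1 then path_weight x k' else 0) * path_weight x l +
       path_weight x k * (if l is l'.+1 then path_weight x l' else 0)).
Proof.
move=> hx mN kN lN /=; set v := path_weight x.
rewrite -!path_weight_pred -/v.
have -> : v k * v l + b * (v k * weight x k * v l + v k * (v l * weight x l)) =
  \sum_(0 <= j < N) ((v k * v l) * particle_rate t x j.+1 +
     (b * v k * v l) * (particle_rate t x j.+1 * (j < k)%:R) +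
     (b * v k * v l) * (particle_rate t x j.+1 * (j < l)%:R)).
  rewrite !big_split /= -!big_distrr /= sum_particle_rate.
  rewrite !sum_particle_rate_lt // (weight_packed_beyond hx mN); ring.
apply: ler_sum => j _; set r := particle_rate t x j.+1.
case: (boolP (unblocked x j)) => h; last first.
  by rewrite /r particle_rate_blocked // !(mul0r, mulr0) !addr0.
have -> : v k * v l * r + b * v k * v l * (r * (j < k)%:R) +
    b * v k * v l * (r * (j < l)%:R) =
  r * ((1 + b * (j < k)%:R + b * (j < l)%:R) * (v k * v l)) by ring.
have t1a : t^-1 = 1 + a by rewrite /a addrC subrK.
have vkl0 : 0 <= v k * v l by rewrite mulr_ge0 // ltW // path_weight_gt0.
apply: ler_wpM2l; first exact: particle_rate_ge0.
rewrite !path_weight_jump // -/v mulrACA; apply: ler_wpM2r => //.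
(* With b = a + a ^ 2, a jump affecting both factors needs (1 + a) ^ 2 <= 1 + 2 b, and one affecting
   a single factor needs a <= b. *)
by rewrite t1a /b; case: (j < k)%N; case: (j < l)%N => /=; nra.
Qed.

(** Defined by the recurrence of the moments; it is the binomial expansion of (1 + c) ^ n truncated
    after the power k, see [binomial_sumE]. *)
Fixpoint binomial_sum (c : R) (n k : nat) : R :=
  if n is n'.+1 then
    binomial_sum c n' k + c * (if k is k'.+1 then binomial_sum c n' k' else 0)
  else 1.

(** Bounds E (v_k - c) ^ 2 / delta ^ 2 after [n] jumps, with the exact mean and the upper bound for
    the second moment. The centre [c] is free, so that it can be the limit instead of the mean. *)
Definition chebyshev_bound (n k : nat) (c delta : R) : R :=
  let a := t^-1 - 1 in
  (binomial_sum (a * (1 + a)) n k ^+ 2 - 2 * c * binomial_sum a n k + c ^+ 2) /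
  delta ^+ 2.

Lemma binomial_sum_ge0 c n k : 0 <= c -> 0 <= binomial_sum c n k.
Proof.
move=> c0; elim: n k => [//|n IH] [|k] /=; first by rewrite mulr0 addr0.
by rewrite addr_ge0 ?mulr_ge0.
Qed.

Lemma steps_path_weight n k : (n <= N)%N -> (k <= N)%N ->
  steps n (path_weight^~ k) packed = binomial_sum a n k.
Proof.
elim: n k => [|n IH] k nN kN; first exact: path_weight_packed.
have p0 := @packed_beyond_packed 0.
rewrite stepsSr (eq_steps p0 (g := fun y => path_weight y k +
   a * (if k is k'.+1 then path_weight y k' else 0))); last first.
  by move=> y hy; rewrite (step_path_weight hy).
rewrite stepsD stepsZ IH ?(ltnW nN) //=; congr (_ + a * _).
case: k kN => [|k] kN; first by rewrite (steps_cst _ p0) // ltnW.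
by apply: IH; exact: ltnW.
Qed.

Lemma steps_path_weightM n k l : (n <= N)%N -> (k <= N)%N -> (l <= N)%N ->
  steps n (fun y => path_weight y k * path_weight y l) packed <=
  binomial_sum b n k * binomial_sum b n l.
Proof.
have p0 := @packed_beyond_packed 0.
have b0 : 0 <= b by apply: mulr_ge0; rewrite // addr_ge0.
elim: n k l => [|n IH] k l nN kN lN; first by rewrite /= !path_weight_packed mulr1.
rewrite stepsSr; apply: (le_trans (le_steps p0 (g := fun y =>
   path_weight y k * path_weight y l +
   b * ((if k is k'.+1 then path_weight y k' else 0) * path_weight y l +
       path_weight y k * (if l is l'.+1 then path_weight y l' else 0))) _)).
  by move=> y hy; rewrite (step_path_weightM hy).
have {}IH := IH _ _ (ltnW nN).
rewrite stepsD stepsZ stepsD /=.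
set B := binomial_sum b n.
pose Bk := if k is k'.+1 then B k' else 0.
pose Bl := if l is l'.+1 then B l' else 0.
rewrite -/Bk -/Bl.
have Bk0 : 0 <= Bk by rewrite /Bk; case: (k) => // k'; exact: binomial_sum_ge0.
have Bl0 : 0 <= Bl by rewrite /Bl; case: (l) => // l'; exact: binomial_sum_ge0.
(* The product of the two recurrences exceeds this expression by the nonnegative term b ^ 2 [Bk]
   [Bl]. *)
apply: (@le_trans _ _ (B k * B l + b * (Bk * B l + B k * Bl))); last first.
  rewrite -subr_ge0; have -> : (B k + b * Bk) * (B l + b * Bl) - (B k * B l +
    b * (Bk * B l + B k * Bl)) = b * b * (Bk * Bl) by ring.
  by do 2!apply: mulr_ge0 => //.
apply: lerD; first exact: IH.
apply: ler_wpM2l => //; apply: lerD.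
  rewrite /Bk; case: k kN {Bk Bk0} => [|k] kN; last by apply: IH => //; exact: ltnW.
  by under eq_fun do rewrite mul0r; rewrite (steps_cst _ p0) ?mul0r // ltnW.
rewrite /Bl; case: l lN {Bl Bl0} => [|l] lN; last by apply: IH => //; exact: ltnW.
by under eq_fun do rewrite mulr0; rewrite (steps_cst _ p0) ?mulr0 // ltnW.
Qed.

Lemma steps_path_weight_chebyshev (D : config -> bool) n k c delta :
  (n <= N)%N -> (k <= N)%N -> 0 < delta ->
  (forall x, D x -> delta <= `|path_weight x k - c|) ->
  steps n (fun x => (D x)%:R) packed <= chebyshev_bound n k c delta.
Proof.
rewrite /chebyshev_bound -/a -/b.
move=> nN kN d0 hD; have p0 := @packed_beyond_packed 0.
have d20 : 0 < delta ^+ 2 by rewrite exprn_gt0.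
(* The indicator of [D] is at most (v_k - c) ^ 2 / delta ^ 2, expanded here into moments. *)
apply: (le_trans (le_steps p0 (g := fun x => (delta ^+ 2)^-1 *
    (path_weight x k * path_weight x k +
     ((- (2 * c)) * path_weight x k + c ^+ 2))) _)).
  move=> x _; have -> : path_weight x k * path_weight x k +
     (- (2 * c) * path_weight x k + c ^+ 2) = (path_weight x k - c) ^+ 2 by ring.
  case: (boolP (D x)) => [/hD dx|_]; last by rewrite mulr_ge0 ?sqr_ge0 // invr_ge0 ltW.
  by rewrite mulrC ler_pdivlMr // mul1r -[leRHS]real_normK ?num_real // lerXn2r ?nnegrE // ltW.
rewrite stepsZ !stepsD stepsZ steps_path_weight // (steps_cst _ p0) // mulrC.
rewrite ler_pM2r ?invr_gt0 // -addrA mulNr.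
by apply: lerD => //; rewrite expr2; exact: steps_path_weightM.
Qed.

End Iteration.


(** * The pointwise order on configurations *)

Definition config_le (x y : config) : Prop :=
  forall k, config_pos x k <= config_pos y k.

Lemma config_le_refl x : config_le x x.
Proof. by []. Qed.

Lemma config_le_trans y x z : config_le x y -> config_le y z -> config_le x z.
Proof. by move=> xy yz k; exact: le_trans (xy k) (yz k). Qed.

Lemma config_le_jump x j : config_le x (jump x j).
Proof.
case: (boolP (unblocked x j)) => h k; last by rewrite jump_blocked.
by rewrite config_pos_jump // lerDl.
Qed.

(** Since t < 1, moving particles to the right lowers the weights and raises the product of their
    inverses. *)
Lemma path_weight_le x y k :
  config_le x y -> path_weight x k <= path_weight y k.
Proof.
move=> xy; apply: ler_prod => j _; rewrite invr_ge0 ltW ?weight_gt0 //=.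
by rewrite lef_pV2 ?posrE ?weight_gt0 // exprz_nonincreasing // lerD2r.
Qed.

Lemma jump_inj x i j : unblocked x i -> unblocked x j ->
  jump x i = jump x j -> i = j.
Proof.
move=> hi hj /(congr1 (config_pos^~ i)); rewrite !config_pos_jump // eqxx.
by case: eqVneq => // _; lia.
Qed.

(** * Law of the jump chain and of the holding times *)

Section MeasurableConfig.
Variables (d : measure_display) (Omega : measurableType d).
Variables f g : Omega -> config.
Hypotheses (mf : measurable_config f) (mg : measurable_config g).

Lemma measurable_config_pos k z : measurable [set w | config_pos (f w) k = z].
Proof. exact: (mf (k := k.+1)). Qed.

Lemma measurable_config_eq x : measurable [set w | f w = x].
Proof.
have -> : [set w | f w = x] =
    \bigcap_k [set w | config_pos (f w) k = config_pos x k].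
  apply/seteqP; split => [w /= fw k _|w hw]; first by rewrite /= fw.
  by apply: config_ext => k; exact: hw.
by apply: bigcapT_measurable => k; exact: measurable_config_pos.
Qed.

(** Positions take countably many values, so a preimage is a countable union of level sets. *)
Lemma measurable_fun_config_pos (h : int -> R) k :
  measurable_fun setT (fun w => h (config_pos (f w) k)).
Proof.
move=> _ B mB; rewrite setTI.
have -> : (fun w => h (config_pos (f w) k)) @^-1` B =
    \bigcup_(z : int) ([set w | config_pos (f w) k = z] `&` [set w | B (h z)]).
  apply/seteqP; split => [w hw|w [z _ [/= <-]]//].
  by exists (config_pos (f w) k).
apply: countable_bigcupT_measurable => [|z]; first exact: countableP.
apply: measurableI; first exact: measurable_config_pos.
have [Bz|Bz] := pselect (B (h z)).
  by rewrite (_ : mkset _ = setT) //; apply/seteqP; split.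
by rewrite (_ : mkset _ = set0) //; apply/seteqP; split.
Qed.

Lemma measurable_path_weight k :
  measurable_fun setT (fun w => path_weight (f w) k).
Proof.
apply: measurable_prod => j _ /=.
exact: (measurable_fun_config_pos (fun z => (t ^ (z + (nat_of_ord j).+1%:Z))^-1)).
Qed.

End MeasurableConfig.

Lemma measurable_config_le d (Omega : measurableType d) (f g : Omega -> config) :
  measurable_config f -> measurable_config g ->
  measurable [set w | config_le (f w) (g w)].
Proof.
move=> mf mg.
have -> : [set w | config_le (f w) (g w)] = \bigcap_k
    ((fun w => ((config_pos (f w) k)%:~R : R) <= (config_pos (g w) k)%:~R) @^-1` [set true]).
  apply/seteqP; split => w hw k => [_|]; first by rewrite /= ler_int hw.
  by have := hw k I; rewrite /= ler_int.
apply: bigcapT_measurable => k; rewrite -[X in measurable X]setTI.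
by apply: measurable_fun_ler => //; exact: measurable_fun_config_pos.
Qed.

Section Skeleton.
Variables (d : measure_display) (Omega : measurableType d).
Variables (P : probability Omega R) (X : R -> Omega -> config).
Variables (Y : nat -> Omega -> config) (H : nat -> Omega -> R).
Hypothesis skel : slowed_tasep_skeleton t P X Y H.

Definition cylinder (m : nat) (p : nat -> config) : set Omega :=
  [set w | forall i, (i <= m)%N -> Y i w = p i].

Definition holds (n : nat) (s : nat -> R) : set Omega :=
  [set w | forall i, (i < n)%N -> s i < H i w].

Definition chain_nondecr (m n : nat) : set Omega :=
  [set w | forall i, (m <= i < n)%N -> config_le (Y i w) (Y i.+1 w)].

Definition cylinder_prob (m : nat) (p : nat -> config) (s : nat -> R) : R :=
  `[< p 0%N = packed >]%:R *
  \prod_(i < m) (transition_rate t (p i) (p i.+1) / total_rate t (p i) *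
                 expR (- (total_rate t (p i) * s i))).

Lemma measurable_cylinder m p : measurable (cylinder m p).
Proof.
have -> : cylinder m p = \bigcap_(i in [set i | (i <= m)%N]) [set w | Y i w = p i].
  by apply/seteqP; split => w hw i im; exact: hw.
apply: bigcap_measurable => [|i _]; first by exists 0%N.
exact/measurable_config_eq/(tasep_measurable_chain skel).
Qed.

Lemma measurable_holds n s : measurable (holds n s).
Proof.
have -> : holds n s = \bigcap_i ((fun w => (i < n)%N ==> (s i < H i w)) @^-1` [set true]).
  apply/seteqP; split => w hw i => [_|]; first by apply/implyP; exact: hw.
  by have /implyP := hw i I.
apply: bigcapT_measurable => i; rewrite -[X in measurable X]setTI.
case: (i < n)%N => /=; last by apply: measurable_cst.
by apply: measurable_fun_ltr => //; exact: (tasep_measurable_hold skel).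
Qed.

Lemma measurable_chain_nondecr m n : measurable (chain_nondecr m n).
Proof.
have -> : chain_nondecr m n =
    \bigcap_(i in [set i | (m <= i < n)%N]) [set w | config_le (Y i w) (Y i.+1 w)].
  by apply/seteqP; split => w hw i im; exact: hw.
have [->|/set0P ne] := eqVneq [set i | (m <= i < n)%N] set0.
  by rewrite bigcap_set0.
apply: bigcap_measurable => // i _.
by apply: measurable_config_le; exact: (tasep_measurable_chain skel).
Qed.

Lemma cylinder_holdsE m p s : (forall i, 0 <= s i) ->
  P (cylinder m p `&` holds m s) = (cylinder_prob m p s)%:E.
Proof. by move=> s0; exact: (tasep_law skel). Qed.

(** Holding times are strictly positive everywhere, so thresholds 0 impose no condition. *)
Lemma cylinderE m p : P (cylinder m p) = (cylinder_prob m p (fun=> 0))%:E.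
Proof.
rewrite -cylinder_holdsE //; congr (P _); apply/seteqP; split => w //.
  by move=> hw; split => // i _; exact: (tasep_hold_gt0 skel).
by case.
Qed.

Definition extend (m : nat) (p : nat -> config) (j : nat) : nat -> config :=
  fun i => if (i <= m)%N then p i else jump (p m) j.

Lemma cylinder_prob_extend m p j s : packed_beyond m (p m) ->
  unblocked (p m) j ->
  cylinder_prob m.+1 (extend m p j) s =
  cylinder_prob m p s * (particle_rate t (p m) j.+1 * expR (- s m)).
Proof.
move=> pm h; rewrite /cylinder_prob big_ord_recr /= mulrA; congr (_ * _ * _).
  by apply: eq_bigr => i _; rewrite /extend (ltnW (ltn_ord i)) ltn_ord.
rewrite /extend leqnn ltnn transition_rate_jump //.
by rewrite (total_rate_packed_beyond pm) divr1 mul1r.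
Qed.

(* Both sides have the same total mass for B = setT, because the rates sum to 1
   over the first N particles. *)
Lemma branch N m p B : packed_beyond m (p m) -> (m < N)%N -> measurable B ->
  P (cylinder m p `&` B) = (\sum_(0 <= j < N)
    P ((if unblocked (p m) j then cylinder m.+1 (extend m p j) else set0) `&` B))%E.
Proof.
move=> pm mN mB.
set S := fun j => if unblocked (p m) j then cylinder m.+1 (extend m p j) else set0.
have mS j : measurable (S j).
  by rewrite /S; case: ifP => // _; exact: measurable_cylinder.
have tS : trivIset setT S.
  apply/trivIsetP => i j _ _ ij; rewrite /S.
  case: ifPn => hi; last by rewrite set0I.
  case: ifPn => hj; last by rewrite setI0.
  apply/seteqP; split => w // [/(_ m.+1 (leqnn _)) hwi /(_ m.+1 (leqnn _))].
  rewrite hwi /extend ltnn => /(jump_inj hi hj) /eqP.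
  by rewrite (negPf ij).
pose U := \big[setU/set0]_(j < N) S j.
have mU : measurable U by apply: bigsetU_measurable.
have SU : U `<=` cylinder m p.
  move=> w; rewrite /U -bigcup_mkord => -[j _]; rewrite /S; case: ifP => // _ hw i im.
  by rewrite hw ?(leqW im) // /extend im.
have PU : P U = P (cylinder m p).
  rewrite /U measure_bigsetU //.
  rewrite cylinderE -(mulr1 (cylinder_prob _ _ _)).
  rewrite -(weight_packed_beyond pm mN) -sum_particle_rate big_distrr /= big_mkord.
  rewrite -sumEFin; apply: eq_bigr => j _; rewrite /S; case: ifPn => h.
    by rewrite cylinderE cylinder_prob_extend // oppr0 expR0 mulr1.
  by rewrite particle_rate_blocked // mulr0 measure0.
have mC := measurable_cylinder m p.
have PD : P (cylinder m p `\` U) = 0%E.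
  have PUC : (P (cylinder m p) - P U = 0)%E by rewrite PU subee // fin_num_measure.
  by rewrite (measureD mC mU) ?ltey_eq ?fin_num_measure // (setIidr SU).
have mCB : measurable (cylinder m p `&` B) by exact: measurableI.
(* Outside [U] the cylinder is null, so intersecting with [U] does not change the probability. *)
rewrite (measureDI P mCB mU) (subset_measure0 _ _ _ PD); first last.
- by move=> w [[hw _] nU]; split.
- exact: measurableD.
- exact: measurableD.
rewrite add0e setIAC (setIidr SU) /U big_distrl /= big_mkord.
apply: (@measure_bigsetU _ _ _ P (fun j => S j `&` B)).
  by move=> j; exact: measurableI.
by under eq_fun do rewrite setIC; exact: trivIset_setIl.
Qed.

(* The jumps and the holding times are independent because all total rates
   are equal to 1. *)
Lemma cylinder_steps N (D : config -> bool) s n m p :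
  (forall i, measurable [set w | D (Y i w)]) -> (forall i, 0 <= s i) ->
  packed_beyond m (p m) -> (m + n <= N)%N ->
  P (cylinder m p `&`
     (holds (m + n) s `&` chain_nondecr m (m + n) `&` [set w | D (Y (m + n) w)])) =
  (cylinder_prob m p s * steps N n (fun x => (D x)%:R) (p m) *
   expR (- \sum_(m <= i < m + n) s i))%:E.
Proof.
move=> mD s0; elim: n m p => [|n IH] m p pm mN.
  rewrite addn0 big_geq // oppr0 expR0 mulr1 /=.
  case: (boolP (D (p m))) => h; last first.
    rewrite mulr0 (_ : _ `&` _ = set0) ?measure0 //.
    by apply/seteqP; split => w // [/(_ m (leqnn _)) e [_]] /=; rewrite e (negPf h).
  rewrite mulr1 -cylinder_holdsE //; congr (P _); apply/seteqP; split => w.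
    by case=> hc [[hh _] _]; split.
  case=> hc hh; split => //; split; last by rewrite /= hc.
  by split => // i; case: ltnP => //; case: leqP.
rewrite (branch pm (N := N)); last 2 first.
- by apply: leq_trans mN; rewrite addnS ltnS leq_addr.
- by do 2?apply: measurableI => //; [exact: measurable_holds|exact: measurable_chain_nondecr].
rewrite /= big_distrr big_distrl /= -sumEFin; apply: eq_bigr => j _.
case: ifPn => h; last by rewrite particle_rate_blocked // mul0r mulr0 mul0r set0I measure0.
transitivity (P (cylinder m.+1 (extend m p j) `&` (holds (m.+1 + n) s `&`
   chain_nondecr m.+1 (m.+1 + n) `&` [set w | D (Y (m.+1 + n) w)]))).
  rewrite addSnnS; congr (P _); apply/seteqP; split => w [hc [[hh hm] hD]].
    by split => //; split => //; split => // i /andP[mi ni]; apply: hm; rewrite ltnW.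
  (* The extra monotonicity condition at i = m is automatic, because the extended path makes a jump
     there. *)
  split => //; split => //; split => // i; rewrite leq_eqVlt => /andP[/orP[/eqP <- _|mi ni]].
    by rewrite !hc // /extend leqnn ltnn; exact: config_le_jump.
  by apply: hm; rewrite mi.
have ext : extend m p j m.+1 = jump (p m) j by rewrite /extend ltnn.
rewrite IH ?addSnnS //; last by rewrite ext; exact: packed_beyond_jump.
rewrite ext cylinder_prob_extend // [in RHS]big_ltn; last by rewrite addnS ltnS leq_addr.
by rewrite opprD expRD; congr EFin; ring.
Qed.

Lemma chain_cylinder_steps N (D : config -> bool) s n :
  (forall i, measurable [set w | D (Y i w)]) -> (forall i, 0 <= s i) ->
  (n <= N)%N ->
  P (cylinder 0 (fun=> packed) `&`
     (holds n s `&` chain_nondecr 0 n `&` [set w | D (Y n w)])) =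
  (steps N n (fun x => (D x)%:R) packed * expR (- \sum_(0 <= i < n) s i))%:E.
Proof.
move=> mD s0 nN.
rewrite (cylinder_steps (N := N) (m := 0) (p := fun=> packed) mD s0) //.
congr (_ * _)%:E; rewrite /cylinder_prob big_ord0 mulr1.
by case: asboolP => // _; rewrite mul1r.
Qed.

Let holds0 n : holds n (fun=> 0) = setT.
Proof. by apply/seteqP; split => w // _ i _; exact: (tasep_hold_gt0 skel). Qed.

Lemma chain_le_steps N n (D : config -> bool) : (n <= N)%N ->
  (forall i, measurable [set w | D (Y i w)]) ->
  (P [set w | D (Y n w)] <= (steps N n (fun x => (D x)%:R) packed)%:E)%E.
Proof.
move=> nN mD.
(* Passing to the complement turns the exact formula, which carries the initial condition and
   monotonicity, into an upper bound for the bare event [D]. *)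
have mDC i : measurable [set w | ~~ D (Y i w)].
  rewrite (_ : mkset _ = ~` [set w | D (Y i w)]); first exact: measurableC.
  by apply/seteqP; split => w /= /negP.
have := chain_cylinder_steps (D := fun x => ~~ D x) mDC (fun=> lexx 0) nN.
rewrite big1 // oppr0 expR0 mulr1 holds0 setTI; set A := _ `&` _ => PA.
have mA : measurable A.
  apply: measurableI; first exact: measurable_cylinder.
  by apply: measurableI => //; exact: measurable_chain_nondecr.
have -> : steps N n (fun x => (D x)%:R) packed =
    1 - steps N n (fun x => (~~ D x)%:R) packed.
  apply/eqP; rewrite -subr_eq0 opprB addrA subr_eq0 -stepsD; apply/eqP.
  rewrite -[RHS](steps_cst 1 (@packed_beyond_packed 0) nN).
  by congr (steps N n _ _); apply/funext => x; case: (D x); rewrite ?addr0 ?add0r.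
rewrite EFinB -PA -probability_setC //; apply: le_measure; rewrite ?inE //.
  exact: measurableC.
by move=> w /= Dw [_ [_]] /=; rewrite Dw.
Qed.

Let settrue : [set _ : Omega | true] = setT.
Proof. by apply/seteqP; split. Qed.

Let measurable_true : measurable [set _ : Omega | true].
Proof. by rewrite settrue. Qed.

Let sure n : P (cylinder 0 (fun=> packed) `&` chain_nondecr 0 n) = 1%E.
Proof.
have := chain_cylinder_steps (D := xpredT) (fun=> measurable_true) (fun=> lexx 0) (leqnn n).
rewrite big1 // oppr0 expR0 mulr1 holds0 setTI settrue setIT => ->.
by rewrite (steps_cst 1 (@packed_beyond_packed 0)).
Qed.

Let measurable_sure n :
  measurable (cylinder 0 (fun=> packed) `&` chain_nondecr 0 n).
Proof.
by apply: measurableI; [exact: measurable_cylinder|exact: measurable_chain_nondecr].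
Qed.

Let sureC n : P (~` (cylinder 0 (fun=> packed) `&` chain_nondecr 0 n)) = 0%E.
Proof. by rewrite probability_setC // sure subee. Qed.

Lemma chain_nondecr_sure n : P (~` chain_nondecr 0 n) = 0%E.
Proof.
have mM := measurable_chain_nondecr 0 n.
apply: (subset_measure0 (B := ~` (cylinder 0 (fun=> packed) `&` chain_nondecr 0 n))).
- exact: measurableC.
- exact: measurableC.
- by move=> w nM [].
- exact: sureC.
Qed.

(** Summing over all paths of the chain: constants are fixed by [steps], and the event of starting
    packed and being nondecreasing has probability 1. *)
Lemma holds_prob n s : (forall i, 0 <= s i) ->
  P (holds n s) = (expR (- \sum_(0 <= i < n) s i))%:E.
Proof.
move=> s0.
have := chain_cylinder_steps (D := xpredT) (fun=> measurable_true) s0 (leqnn n).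
rewrite settrue setIT (steps_cst 1 (@packed_beyond_packed 0)) // mul1r => <-.
have mS := measurable_sure n.
rewrite (measureDI P (measurable_holds n s) mS) (subset_measure0 _ _
  (B := ~` (cylinder 0 (fun=> packed) `&` chain_nondecr 0 n))).
- by rewrite add0e setIA [X in P (X `&` _)]setIC -setIA.
- by apply: measurableD => //; exact: measurable_holds.
- exact: measurableC.
- by move=> w [].
- exact: sureC.
Qed.

Lemma chain_nondecr_le m n i j w : chain_nondecr m n w -> (m <= i <= j)%N -> (j <= n)%N ->
  config_le (Y i w) (Y j w).
Proof.
move=> hm /andP[mi]; elim: j => [|j IH]; first by rewrite leqn0 => /eqP -> _; exact: config_le_refl.
rewrite leq_eqVlt => /predU1P[-> _|]; first exact: config_le_refl.
rewrite ltnS => ij jn.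
apply: (config_le_trans (IH ij (ltnW jn))).
by apply: hm; rewrite jn (leq_trans mi).
Qed.
End Skeleton.
End Rates.

(** * Law of large numbers for the holding times *)

Section LayerCake.
Variables (R : realType) (d : measure_display) (Omega : measurableType d).
Variable P : probability Omega R.
Local Notation leb := (@lebesgue_measure R).

Lemma measurable_superlevel (h : Omega -> R) (s : R) :
  measurable_fun setT h -> measurable [set w | (s < h w)%R].
Proof.
move=> mh; rewrite (_ : mkset _ = (fun w => s < h w) @^-1` [set true]) //.
by rewrite -[X in measurable X]setTI; apply: measurable_fun_ltr.
Qed.

(** Exponential bounds are written as multiples of a probability density, so that their integral is
    its total mass. *)
Let exp_integral (C c : R) : 0 <= C -> 0 < c ->
  (\int[leb]_s (C / c * exponential_pdf c s)%:E = (C / c)%:E)%E.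
Proof.
move=> C0 c0; under eq_integral do rewrite EFinM.
rewrite ge0_integralZl //; last 3 first.
- by apply/measurable_EFinP; exact: measurable_exponential_pdf.
- by move=> s _; rewrite lee_fin exponential_pdf_ge0 // ltW.
- by rewrite lee_fin divr_ge0 // ltW.
by rewrite integral_exponential_pdf // mule1.
Qed.

Let exp_pdfE (C c s : R) : 0 < c -> 0 <= s ->
  C / c * exponential_pdf c s = C * expR (- (c * s)).
Proof.
move=> c0 s0; rewrite exponential_pdfE // mulrA divfK ?gt_eqF //.
by rewrite mulNr.
Qed.

Section Tail.
Variables (g h : Omega -> R).
Hypotheses (mg : measurable_fun setT g) (mh : measurable_fun setT h).
Hypotheses (g0 : forall w, 0 <= g w) (h0 : forall w, 0 <= h w).

Let tail (z : Omega * R) : \bar R := (g z.1 * \1_(`[0, h z.1[) z.2)%:E.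

Let tail_ge0 z : (0 <= tail z)%E.
Proof. by rewrite lee_fin mulr_ge0. Qed.

Let measurable_tail : measurable_fun setT tail.
Proof.
apply/measurable_EFinP; apply: measurable_funM => /=.
  exact: measurableT_comp mg measurable_fst.
rewrite (_ : (fun _ => _) = \1_([set z : Omega * R | (0 <= z.2) && (z.2 < h z.1)])).
  apply: measurable_indic; rewrite (_ : mkset _ =
     (fun z : Omega * R => (0 <= z.2) && (z.2 < h z.1)) @^-1` [set true]) //.
  rewrite -[X in measurable X]setTI; apply: measurable_and => //.
    by apply: measurable_fun_ler.
  by apply: measurable_fun_ltr => //; exact: measurableT_comp mh measurable_fst.
by apply/funext => z; rewrite !indicE; congr (_%:R).
Qed.

(** Integrating the indicator of 0 <= s < h over s gives h; Tonelli exchanges the two integrals. *)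
Let layer_cake :
  (\int[P]_w (g w * h w)%:E = \int[leb]_s \int[P]_w tail (w, s))%E.
Proof.
rewrite -(fubini_tonelli (m1 := P) (m2 := leb)) //.
apply: eq_integral => w _; rewrite /tail /=.
under eq_integral do rewrite EFinM.
rewrite ge0_integralZl //; last 2 first.
- by apply/measurable_EFinP/measurable_indic.
- by rewrite lee_fin.
rewrite integral_indic //= setIT lebesgue_measure_itv /= lte_fin EFinM.
have [_|hw] := ltP 0 (h w); first by rewrite -EFinB subr0.
by rewrite (_ : h w = 0) //; apply/eqP; rewrite eq_le hw h0.
Qed.

Let tail_lt0 s : s < 0 -> (\int[P]_w tail (w, s) = 0)%E.
Proof.
move=> s0; apply: integral0_eq => w _; rewrite /tail /= indicE memNset ?mulr0 //.
by rewrite /= in_itv /= leNgt s0.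
Qed.

Let tailE s : 0 <= s ->
  (\int[P]_w tail (w, s) = \int[P]_w (g w * \1_([set w | (s < h w)%R]) w)%:E)%E.
Proof.
move=> s0; apply: eq_integral => w _; rewrite /tail /= !indicE.
by congr ((_ * (nat_of_bool _)%:R)%:E); apply/idP/idP; rewrite !inE /= in_itv /= s0.
Qed.

Let measurable_tail_integral :
  measurable_fun setT (fun s : R => \int[P]_w tail (w, s))%E.
Proof. exact: (measurable_fun_fubini_tonelli_G (m1 := P) tail measurable_tail tail_ge0). Qed.

Let measurable_exp (C c : R) :
  measurable_fun setT (fun s => (C / c * exponential_pdf c s)%:E).
Proof.
apply/measurable_EFinP; apply: measurable_funM => //.
exact: measurable_exponential_pdf.
Qed.

(** The weight [g] allows the estimate to be applied twice when bounding the mean of a product. *)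
Lemma expectation_le_exp (C c : R) : 0 <= C -> 0 < c ->
  (forall s, (0 <= s)%R ->
    \int[P]_w (g w * \1_([set w | (s < h w)%R]) w)%:E <= (C * expR (- (c * s)))%:E)%E ->
  (\int[P]_w (g w * h w)%:E <= (C / c)%:E)%E.
Proof.
move=> C0 c0 le; rewrite layer_cake -exp_integral //.
apply: ge0_le_integral => //.
- by move=> s _; apply: integral_ge0.
- exact: measurable_exp.
- move=> s _; have [s0|s0] := leP 0 s; first by rewrite tailE // exp_pdfE // le.
  by rewrite tail_lt0 // lt0_exponential_pdf // mulr0.
Qed.

Lemma expectation_ge_exp (C c : R) : 0 <= C -> 0 < c ->
  (forall s, (0 <= s)%R ->
    (C * expR (- (c * s)))%:E <= \int[P]_w (g w * \1_([set w | (s < h w)%R]) w)%:E)%E ->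
  ((C / c)%:E <= \int[P]_w (g w * h w)%:E)%E.
Proof.
move=> C0 c0 le; rewrite layer_cake -exp_integral //.
apply: ge0_le_integral => //.
- by move=> s _; rewrite lee_fin mulr_ge0 ?divr_ge0 ?exponential_pdf_ge0 // ltW.
- exact: measurable_exp.
- move=> s _; have [s0|s0] := leP 0 s; first by rewrite tailE // exp_pdfE // le.
  by rewrite tail_lt0 // lt0_exponential_pdf // mulr0.
Qed.

End Tail.

Lemma expectationM_le (g h : Omega -> R) (c : R) :
  measurable_fun setT g -> measurable_fun setT h ->
  (forall w, 0 <= g w) -> (forall w, 0 <= h w) -> 0 < c ->
  (forall s u, (0 <= s)%R -> (0 <= u)%R ->
     P ([set w | (s < h w)%R] `&` [set w | (u < g w)%R]) <=
       (expR (- (c * s)) * expR (- (c * u)))%:E)%E ->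
  (\int[P]_w (g w * h w)%:E <= (c^-1 / c)%:E)%E.
Proof.
move=> mg mh g0 h0 c0 le; apply: expectation_le_exp; rewrite ?invr_ge0 ?ltW // => s s0.
(* Second layer: [g] becomes the function to be cut into levels, the indicator of s < h becomes the
   weight, and the constant is [expR (- (c * s))]. *)
rewrite [c^-1 * _]mulrC.
under eq_integral do rewrite mulrC.
apply: expectation_le_exp => //; first exact/measurable_indic/measurable_superlevel.
move=> u u0; apply: le_trans (le s u s0 u0).
have -> : (fun w => (\1_([set w | (s < h w)%R]) w * \1_([set w | (u < g w)%R]) w)%:E) =
    (fun w => (\1_([set w | (s < h w)%R] `&` [set w | (u < g w)%R]) w)%:E) :> (Omega -> \bar R).
  by apply/funext => w; rewrite indicI.
rewrite integral_indic ?setIT //.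
by apply: measurableI; exact: measurable_superlevel.
Qed.

End LayerCake.

Section HoldingTimes.
Variables (R : realType) (d : measure_display) (Omega : measurableType d).
Variables (P : probability Omega R) (H : nat -> Omega -> R).
Hypothesis mH : forall n, measurable_fun setT (H n).
Hypothesis H_gt0 : forall n w, 0 < H n w.
Hypothesis H_exp : forall n s, (forall i, 0 <= s i) ->
  P [set w | forall i, (i < n)%N -> s i < H i w] =
  (expR (- \sum_(0 <= i < n) s i))%:E.

Let sum_single n i (s : R) : (i < n)%N ->
  \sum_(0 <= k < n) (if k == i then s else 0) = s.
Proof. by move=> ni; rewrite -big_mkcond /= big_nat1_eq ni. Qed.

(** All thresholds other than the i-th are set to 0, where they hold surely. *)
Lemma hold_tail i s : 0 <= s -> P [set w | s < H i w] = (expR (- s))%:E.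
Proof.
move=> s0; rewrite -[in RHS](sum_single s (ltnSn i)) -H_exp; last by move=> k; case: ifP.
congr (P _); apply/seteqP; split => w /= hw; last by have := hw i (ltnSn i); rewrite eqxx.
by move=> k _; case: eqVneq => [->|].
Qed.

Lemma hold_tail2 i j s u : i != j -> 0 <= s -> 0 <= u ->
  P ([set w | s < H i w] `&` [set w | u < H j w]) =
  (expR (- s) * expR (- u))%:E.
Proof.
move=> ij s0 u0; pose n := (maxn i j).+1.
have ni : (i < n)%N by rewrite ltnS leq_maxl.
have nj : (j < n)%N by rewrite ltnS leq_maxr.
rewrite -expRD -opprD -[in RHS](sum_single s ni) -[in RHS](sum_single u nj) -big_split /=.
rewrite -H_exp; last by move=> k; apply: addr_ge0; case: ifP.
congr (P _); apply/seteqP; split => w /=.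
  case=> hi hj k _; case: eqVneq => [->|_]; first by rewrite (negPf ij) addr0.
  by case: eqVneq => [->|_]; rewrite add0r.
move=> hw; have := hw i ni; have := hw j nj.
by rewrite !eqxx (negPf ij) eq_sym (negPf ij) add0r addr0.
Qed.

Let H_ge0 n w : 0 <= H n w. Proof. exact: ltW. Qed.

(** The diagonal value 4 comes from tails of rate 1 / 2 and is cruder than the exact 2; it still
    keeps the variance of [jump_time] linear in n. *)
Lemma hold_moment2 i j :
  (\int[P]_w (H i w * H j w)%:E <= (if i == j then 4 else 1)%:E)%E.
Proof.
case: eqVneq => [->|ij].
  rewrite (_ : 4%R = (1 / 2)^-1 / (1 / 2)); last by field.
  (* exp (- max s u) <= exp (- s / 2) exp (- u / 2). *)
  apply: expectationM_le => // s u s0 u0; rewrite -expRD.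
  have half x y : 0 <= x <= y -> (P [set w | (y < H j w)%R] <=
      (expR (- (1 / 2 * x) + - (1 / 2 * y)))%:E)%E.
    move=> /andP[x0 xy]; rewrite hold_tail ?(le_trans x0) // lee_fin ler_expR; lra.
  have [su|/ltW us] := leP s u.
    apply: le_trans (half s u _); last by rewrite s0.
    apply: le_measure; rewrite ?inE; first by apply: measurableI; exact: measurable_superlevel.
      exact: measurable_superlevel.
    by move=> w [].
  rewrite addrC; apply: le_trans (half u s _); last by rewrite u0.
  apply: le_measure; rewrite ?inE; first by apply: measurableI; exact: measurable_superlevel.
    exact: measurable_superlevel.
  by move=> w [].
rewrite (_ : 1%R = 1^-1 / 1); last by rewrite invr1 mulr1.
apply: expectationM_le => // s u s0 u0.
by rewrite hold_tail2 ?mul1r 1?eq_sym.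
Qed.

(** The lower bound is the useful side, as the mean enters the expanded square of J - n with a
    negative sign. *)
Lemma hold_mean_ge1 i : (1 <= \int[P]_w (H i w)%:E)%E.
Proof.
rewrite (_ : 1%E = (1 / 1)%:E); last by rewrite divr1.
rewrite (eq_integral (fun w => (1 * H i w)%:E)); last by move=> w _; rewrite mul1r.
apply: expectation_ge_exp => // s s0.
under eq_integral do rewrite mul1r.
rewrite integral_indic ?setIT ?mul1r //; last exact: measurable_superlevel.
by rewrite -(hold_tail i s0).
Qed.

Local Notation J := (jump_time H).

Lemma measurable_jump_time n : measurable_fun setT (J n).
Proof. by apply: measurable_sum => i; exact: mH. Qed.

Lemma jump_time_moment2 n :
  (\int[P]_w ((J n w - n%:R) ^+ 2)%:E <= (3 * n%:R)%:E)%E.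
Proof.
have mJ := measurable_jump_time n.
have J0 w : 0 <= J n w by exact: sumr_ge0.
have EJ : (n%:R%:E <= \int[P]_w (J n w)%:E)%E.
  under eq_integral do rewrite /jump_time -sumEFin.
  rewrite ge0_integral_sum //; first last.
  - by move=> i w _; rewrite lee_fin.
  - by move=> i; apply/measurable_EFinP.
  rewrite -[n in leLHS]card_ord -sumr_const -sumEFin.
  by apply: lee_sum => i _; exact: hold_mean_ge1.
have EJ2 : (\int[P]_w (J n w ^+ 2)%:E <= (n%:R ^+ 2 + 3 * n%:R)%:E)%E.
  under eq_integral => w _.
    rewrite expr2 /jump_time big_distrlr /= -sumEFin.
    under eq_bigr do rewrite -sumEFin.
    over.
  rewrite ge0_integral_sum //; first last.
  - by move=> i w _; apply: sume_ge0 => j _; rewrite lee_fin mulr_ge0.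
  - move=> i; apply: emeasurable_sum => j.
    by apply/measurable_EFinP; exact: measurable_funM.
  (* Each of the n ^ 2 pairs contributes 1, and each of the n diagonal pairs 3 more. *)
  have -> : n%:R ^+ 2 + 3 * n%:R =
      \sum_(i < n) \sum_(j < n) (if i == j then 4 else 1) :> R.
    under eq_bigr => i _.
      rewrite (eq_bigr (fun j => 1 + if j == i then 3 else 0)); last first.
        by move=> j _; rewrite eq_sym; case: ifP => _; ring.
      rewrite big_split /= -big_mkcond /= big_pred1_eq sumr_const card_ord; over.
    by rewrite sumr_const card_ord -[in LHS]mulr_natl; ring.
  rewrite -sumEFin; apply: lee_sum => i _.
  rewrite ge0_integral_sum //; first last.
  - by move=> j w _; rewrite lee_fin mulr_ge0.
  - by move=> j; apply/measurable_EFinP; exact: measurable_funM.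
  by rewrite -sumEFin; apply: lee_sum => j _; exact: hold_moment2.
have mS : measurable_fun setT (fun w => ((J n w - n%:R) ^+ 2)%:E).
  by apply/measurable_EFinP; apply: measurable_funX; exact: measurable_funB.
have n0 : (0 <= n%:R :> R) by [].
(* The cross term of the square stays on the left, so that all integrands are nonnegative and no
   extended reals are subtracted. *)
have key : (\int[P]_w ((J n w - n%:R) ^+ 2)%:E + (2 * n%:R)%:E * \int[P]_w (J n w)%:E =
   \int[P]_w (J n w ^+ 2)%:E + (n%:R ^+ 2)%:E)%E.
  rewrite -ge0_integralZl //; [|exact/measurable_EFinP|by move=> w _; rewrite lee_fin].
  rewrite -ge0_integralD //; first last.
  - by apply: emeasurable_funM => //; apply/measurable_EFinP.
  - by move=> w _; rewrite -EFinM lee_fin !mulr_ge0.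
  - by move=> w _; rewrite lee_fin sqr_ge0.
  have -> : ((n%:R ^+ 2)%:E = \int[P]_w (cst (n%:R ^+ 2)%:E w))%E.
    by rewrite integral_cst // -[LHS]mule1 -(probability_setT P).
  rewrite -ge0_integralD //; first last.
  - by move=> w _; rewrite lee_fin sqr_ge0.
  - by apply/measurable_EFinP; apply: measurable_funX.
  - by move=> w _; rewrite lee_fin sqr_ge0.
  apply: eq_integral => w _; rewrite -EFinM -!EFinD; congr EFin; ring.
have : ((2 * n%:R)%:E * n%:R%:E <= (2 * n%:R)%:E * \int[P]_w (J n w)%:E)%E.
  by apply: lee_wpmul2l => //; rewrite lee_fin mulr_ge0.
move: key EJ2; set A := (\int[P]_w ((J n w - n%:R) ^+ 2)%:E)%E.
set B := (_ * _)%E; set C := (\int[P]_w (J n w ^+ 2)%:E)%E.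
have A0 : (0 <= A)%E by apply: integral_ge0 => w _; rewrite lee_fin sqr_ge0.
have C0 : (0 <= C)%E by apply: integral_ge0 => w _; rewrite lee_fin sqr_ge0.
case: C C0 => [c| |] // _; rewrite lee_fin => + hc; rewrite -EFinD.
case: A A0 => [a| |] //; case: B => [b'| |] //= _ [].
by rewrite -EFinM !lee_fin; nra.
Qed.

Lemma jump_time_chebyshev n r : 0 < r ->
  (P [set w | (r <= `|J n w - n%:R|)%R] <= (3 * n%:R / r ^+ 2)%:E)%E.
Proof.
move=> r0; set D := mkset _.
have mJ := measurable_jump_time n.
have mD : measurable D.
  rewrite (_ : D = (fun w => r <= `|J n w - n%:R|) @^-1` [set true]) //.
  rewrite -[X in measurable X]setTI; apply: measurable_fun_ler => //.
  by apply: measurableT_comp => //; exact: measurable_funB.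
have r20 : 0 < r ^+ 2 by exact: exprn_gt0.
suff : (P D * (r ^+ 2)%:E <= (3 * n%:R)%:E)%E by rewrite [in X in _ -> X]EFinM lee_pdivlMr.
have -> : (P D * (r ^+ 2)%:E = \int[P]_w ((r ^+ 2)%:E * (\1_D w)%:E))%E.
  rewrite ge0_integralZl //; last 2 first.
  - by apply/measurable_EFinP; exact: measurable_indic.
  - by rewrite lee_fin ltW.
  by rewrite integral_indic // setIT muleC.
apply: le_trans (jump_time_moment2 n); apply: ge0_le_integral => //.
- by move=> w _; rewrite -EFinM lee_fin mulr_ge0 // ltW.
- by apply: emeasurable_funM => //; apply/measurable_EFinP; exact: measurable_indic.
- by apply/measurable_EFinP; apply: measurable_funX; exact: measurable_funB.
move=> w _; rewrite -EFinM lee_fin indicE.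
case: (boolP (w \in D)); rewrite ?mulr0 ?sqr_ge0 // inE mulr1 /D /= => hD.
by rewrite -[leRHS]real_normK ?num_real // lerXn2r ?nnegrE // ltW.
Qed.

End HoldingTimes.

(** * Scaling limits *)

Section Limits.
Variable R : realType.

(** The recurrence is Pascal's rule. *)
Lemma binomial_sumE (c : R) n k :
  binomial_sum c n k = \sum_(0 <= j < k.+1) 'C(n, j)%:R * c ^+ j.
Proof.
elim: n k => [|n IH] k /=.
  rewrite big_nat_recl // bin0 mul1r big1 ?addr0 // => j _.
  by rewrite bin0n mul0r.
rewrite big_nat_recl // bin0 mul1r expr0.
under eq_bigr do rewrite binS natrD mulrDl.
rewrite big_split /= addrA IH big_nat_recl // bin0 mul1r expr0; congr (_ + _).
case: k => [|k]; first by rewrite big_geq // mulr0.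
by rewrite IH big_distrr /=; apply: eq_bigr => j _; rewrite exprS mulrCA.
Qed.

(** Taylor polynomial of the exponential with [k] terms, so [binomial_sum] of index k is to be
    compared with [exp_sum] of index [k.+1]. *)
Definition exp_sum (theta : R) (k : nat) : R :=
  \sum_(0 <= j < k) theta ^+ j / j`!%:R.

Lemma exp_sum_gt0 theta k : 0 < theta -> 0 < exp_sum theta k.+1.
Proof.
move=> theta0; rewrite /exp_sum big_nat_recl // expr0 fact0 divr1.
apply: ltr_pwDl => //; apply: sumr_ge0 => j _.
by rewrite divr_ge0 // exprn_ge0 // ltW.
Qed.

Lemma continuous_exp_sum k : continuous (exp_sum^~ k).
Proof.
elim: k => [|k IH] x.
  rewrite (_ : exp_sum^~ 0%N = cst 0); first exact: cst_continuous.
  by apply/funext => y; rewrite /exp_sum big_geq.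
rewrite (_ : exp_sum^~ k.+1 = (fun y => exp_sum y k + y ^+ k / k`!%:R)).
  apply: cvgD; first exact: IH.
  by apply: cvgMl; exact: exprn_continuous.
by apply/funext => y; rewrite /exp_sum big_nat_recr.
Qed.

Lemma cvg_binomial_sum (F : set_system R) {FF : Filter F} (c : R -> R)
    (n : R -> nat) (theta : R) k :
  c x @[x --> F] --> 0 -> c x * (n x)%:R @[x --> F] --> theta ->
  binomial_sum (c x) (n x) k @[x --> F] --> exp_sum theta k.+1.
Proof.
move=> c0 cn.
have term j : 'C(n x, j)%:R * c x ^+ j @[x --> F] --> theta ^+ j / j`!%:R.
  elim: j => [|j IH].
    under eq_fun do rewrite bin0 mul1r expr0.
    by rewrite expr0 fact0 divr1; exact: cvg_cst.
  (* The ratio of consecutive terms is (c n - c j) / (j + 1), which tends to theta / (j + 1). *)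
  have E x : 'C(n x, j.+1)%:R * c x ^+ j.+1 =
      ('C(n x, j)%:R * c x ^+ j) * ((c x * (n x)%:R - c x * j%:R) / j.+1%:R).
    have j1 : j.+1%:R != 0 :> R by rewrite pnatr_eq0.
    apply: (mulIf j1); rewrite -[RHS]mulrA divfK //.
    have : 'C(n x, j.+1)%:R * j.+1%:R = 'C(n x, j)%:R * ((n x)%:R - j%:R) :> R.
      (* For n < j both binomials vanish; otherwise the real difference n - j agrees with the
         natural one. *)
      have [nj|jn] := ltnP (n x) j.
        by rewrite !bin_small ?mul0r // ltnW.
      by rewrite -natrB // -!natrM mulnC mul_bin_left mulnC.
    move=> e; rewrite mulrAC e exprS; set u := _%:R; set v := (n x)%:R; ring.
  under eq_fun do rewrite E.
  have -> : theta ^+ j.+1 / j.+1`!%:R =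
      theta ^+ j / j`!%:R * ((theta - 0 * j%:R) / j.+1%:R).
    rewrite factS natrM exprS; field.
    by rewrite addrC natr1 !pnatr_eq0 -!lt0n fact_gt0.
  by apply: cvgM IH _; apply: cvgMl; apply: cvgB => //; exact: cvgMl.
under eq_fun do rewrite binomial_sumE.
rewrite /exp_sum; elim: k.+1 => [|m IH].
  rewrite big_geq // (_ : (fun x => _) = cst 0); first exact: cvg_cst.
  by apply/funext => x; rewrite big_geq.
rewrite big_nat_recr //= (_ : (fun x => _) = (fun x =>
  \sum_(0 <= j < m) 'C(n x, j)%:R * c x ^+ j + 'C(n x, m)%:R * c x ^+ m)).
  exact: cvgD.
by apply/funext => x; rewrite big_nat_recr.
Qed.

Lemma cvg_id_right : (x @[x --> (0 : R)^'+]) --> (0 : R).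
Proof. exact: cvg_within. Qed.

Lemma cvg_expR_right : expR x @[x --> (0 : R)^'+] --> (1 : R).
Proof.
by rewrite -[1]expR0; apply: continuous_cvg; [exact: continuous_expR|exact: cvg_id_right].
Qed.

Lemma cvg_scaled_truncn (sigma : R) : 0 < sigma ->
  x * (Num.truncn (sigma / x))%:R @[x --> (0 : R)^'+] --> sigma.
Proof.
move=> s0; apply: (squeeze_cvgr (f := fun x => sigma - x) (h := cst sigma)).
- near=> x; have x0 : 0 < x by near: x; exact: nbhs_right_gt.
  have /andP[lo hi] : (Num.truncn (sigma / x))%:R <= sigma / x <
      (Num.truncn (sigma / x)).+1%:R by rewrite truncn_itv // divr_ge0 // ltW.
  rewrite ler_pdivlMr // in lo; rewrite ltr_pdivrMr // -natr1 in hi.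
  by rewrite /=; apply/andP; split; nra.
- by rewrite -[X in _ --> X]subr0; apply: cvgB; [exact: cvg_cst|exact: cvg_id_right].
- exact: cvg_cst.
Unshelve. all: by end_near. Qed.

Lemma cvg_expR_truncn (sigma : R) : 0 < sigma ->
  (expR x - 1) * (Num.truncn (sigma / x))%:R @[x --> (0 : R)^'+] --> sigma.
Proof.
move=> s0; have e := cvg_scaled_truncn s0.
apply: (squeeze_cvgr (f := fun x => x * (Num.truncn (sigma / x))%:R)
   (h := fun x => x * (Num.truncn (sigma / x))%:R * expR x)) => //.
- near=> x; have x0 : 0 < x by near: x; exact: nbhs_right_gt.
  (* The two inequalities give x <= exp x - 1 <= x exp x. *)
  have lo := expR_ge1Dx x; have := expR_ge1Dx (- x).
  rewrite expRN -[leRHS]mul1r ler_pdivlMr ?expR_gt0 // => hi.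
  set n := _%:R; have n0 : 0 <= n by exact: ler0n.
  by apply/andP; split; [apply: ler_wpM2r => //|rewrite mulrAC; apply: ler_wpM2r => //]; nra.
- by rewrite -[X in _ --> X]mulr1; apply: cvgM => //; exact: cvg_expR_right.
Unshelve. all: by end_near. Qed.

(** Since a tends to 0, both a n and a (1 + a) n tend to [sigma]; both sums tend to c and the
    numerator to c ^ 2 - 2 c ^ 2 + c ^ 2 = 0. *)
Lemma cvg_chebyshev_bound (sigma delta : R) k : 0 < sigma ->
  (let a := expR x - 1 in let n := Num.truncn (sigma / x) in
   let c := exp_sum sigma k.+1 in
   (binomial_sum (a * (1 + a)) n k ^+ 2 - 2 * c * binomial_sum a n k + c ^+ 2) /
    delta ^+ 2) @[x --> (0 : R)^'+] --> (0 : R).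
Proof.
move=> s0 /=; set c := exp_sum sigma k.+1.
have a0 : expR x - 1 @[x --> (0 : R)^'+] --> (0 : R).
  by rewrite -[X in _ --> X](subrr 1); apply: cvgB; [exact: cvg_expR_right|exact: cvg_cst].
have b1 : 1 + (expR x - 1) @[x --> (0 : R)^'+] --> (1 : R).
  by rewrite -[X in _ --> X]addr0; apply: cvgD => //; exact: cvg_cst.
have an := cvg_expR_truncn s0.
have A := cvg_binomial_sum (k := k) a0 an.
have B : binomial_sum ((expR x - 1) * (1 + (expR x - 1)))
    (Num.truncn (sigma / x)) k @[x --> (0 : R)^'+] --> c.
  apply: cvg_binomial_sum.
    by rewrite -[X in _ --> X](mul0r 1); apply: cvgM.
  rewrite (_ : (fun x => _) = (fun x => (expR x - 1) *
     (Num.truncn (sigma / x))%:R * (1 + (expR x - 1)))); last first.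
    by apply/funext => x; exact: mulrAC.
  by rewrite -[X in _ --> X]mulr1; apply: cvgM.
rewrite [X in _ --> X](_ : _ = (c ^+ 2 - 2 * c * c + c ^+ 2) / delta ^+ 2); last ring.
apply: cvgMl; apply: cvgD; last exact: cvg_cst.
apply: cvgB; last by apply: cvgMr; exact: A.
by rewrite expr2; apply: cvgM.
Qed.

Lemma cvg_jump_bound (sigma eta : R) : 0 < sigma -> 0 < eta ->
  3 * (Num.truncn (sigma / x))%:R / (eta / x) ^+ 2 @[x --> (0 : R)^'+] --> (0 : R).
Proof.
move=> s0 eta0.
have -> : (fun x => 3 * (Num.truncn (sigma / x))%:R / (eta / x) ^+ 2) =
   (fun x => 3 / eta ^+ 2 * ((x * (Num.truncn (sigma / x))%:R) * x)).
  (* The functions also agree at x = 0, where the convention that 0 has inverse 0 makes both sides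
     0. *)
  apply/funext => x; have [->|x0] := eqVneq x 0.
    by rewrite invr0 !mulr0 expr0n invr0 mulr0.
  by field; rewrite x0 gt_eqF.
rewrite [X in _ --> X](_ : _ = 3 / eta ^+ 2 * (sigma * 0)); last by rewrite !mulr0.
apply: cvgMr; apply: cvgM; first exact: cvg_scaled_truncn.
exact: cvg_id_right.
Qed.

End Limits.

(** * From the jump chain to continuous time *)

Lemma exists_crossing (R : realType) (u : nat -> R) (a b : nat) (T : R) :
  (a <= b)%N -> u a <= T < u b -> exists2 n, (a <= n < b)%N & u n <= T < u n.+1.
Proof.
move=> ab /andP[ua ub].
have ex : exists i, T < u (a + i)%N by exists (b - a)%N; rewrite subnKC.
case: (ex_minnP ex) => -[|i]; first by rewrite addn0 ltNge ua.
move=> ui min; exists (a + i)%N.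
  rewrite leq_addr /= -(subnKC ab) ltn_add2l.
  by apply: min; rewrite subnKC.
rewrite -addnS ui andbT leNgt; apply/negP => /min.
by rewrite ltnn.
Qed.

Section Sandwich.
Variables (R : realType) (t : R).
Hypothesis t01 : 0 < t < 1.
Variables (d : measure_display) (Omega : measurableType d).
Variables (P : probability Omega R) (X : R -> Omega -> config).
Variables (Y : nat -> Omega -> config) (H : nat -> Omega -> R).
Hypothesis skel : slowed_tasep_skeleton t P X Y H.

Lemma measurable_path_weight_far f k c delta : measurable_config f ->
  measurable [set w : Omega | delta <= `|path_weight t (f w) k - c|].
Proof.
move=> mf; rewrite (_ : mkset _ =
  (fun w => delta <= `|path_weight t (f w) k - c|) @^-1` [set true]) //.
rewrite -[X in measurable X]setTI; apply: measurable_fun_ler => //.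
apply: measurableT_comp => //; apply: measurable_funB => //.
exact: measurable_path_weight.
Qed.

Lemma chain_path_weight n k c delta : 0 < delta ->
  (P [set w | (delta <= `|path_weight t (Y n w) k - c|)%R] <=
   (chebyshev_bound t n k c delta)%:E)%E.
Proof.
move=> d0.
apply: (le_trans (chain_le_steps t01 skel (N := maxn n k)
  (D := fun x => delta <= `|path_weight t x k - c|) (leq_maxl _ _) _)).
  by move=> i; apply: measurable_path_weight_far; exact: (tasep_measurable_chain skel).
by rewrite lee_fin; apply: steps_path_weight_chebyshev; rewrite ?leq_maxl ?leq_maxr.
Qed.

(** Unless a jump time deviates by [r], at least [n1] and fewer than [n2] jumps occur by time [T];
    monotonicity then squeezes v_k between its values at these two steps. In particular no explosion
    occurs before [T] on the good event. *)
Lemma path_weight_sandwich T n1 n2 r k c1 c2 c delta e :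
  measurable_config (X T) -> 0 < r -> 0 < delta ->
  n1%:R + r <= T -> T + r <= n2%:R ->
  c - e <= c1 - delta -> c2 + delta <= c + e ->
  (P [set w | (e <= `|path_weight t (X T w) k - c|)%R] <=
   (chebyshev_bound t n1 k c1 delta + chebyshev_bound t n2 k c2 delta +
    3 * n1%:R / r ^+ 2 + 3 * n2%:R / r ^+ 2)%:E)%E.
Proof.
move=> mX r0 d0 n1T Tn2 c1e c2e.
pose A n c := [set w | delta <= `|path_weight t (Y n w) k - c|].
pose B n := [set w | r <= `|jump_time H n w - n%:R|].
have mH := tasep_measurable_hold skel.
have mA n c' : measurable (A n c').
  by apply: measurable_path_weight_far; exact: (tasep_measurable_chain skel).
have mB n : measurable (B n).
  rewrite /B (_ : mkset _ = (fun w => r <= `|jump_time H n w - n%:R|) @^-1` [set true]) //.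
  rewrite -[X in measurable X]setTI; apply: measurable_fun_ler => //.
  apply: measurableT_comp => //; apply: measurable_funB => //.
  exact: measurable_jump_time.
pose M := ~` chain_nondecr Y 0 n2.
have mM : measurable M by apply: measurableC; exact: (measurable_chain_nondecr skel).
have sub : [set w | e <= `|path_weight t (X T w) k - c|] `<=`
    A n1 c1 `|` A n2 c2 `|` B n1 `|` B n2 `|` M.
  move=> w /= far; apply: contrapT => /not_orP[/not_orP[/not_orP[/not_orP[]]]].
  rewrite /A /B /M /= => /negP nA1 /negP nA2 /negP nB1 /negP nB2 /contrapT hM.
  move: nA1 nA2 nB1 nB2; rewrite -!ltNge !ltr_norml.
  move=> /andP[a1 _] /andP[_ a2] /andP[_ b1] /andP[b2 _].
  have n12 : (n1 <= n2)%N by rewrite -(ler_nat R); lra.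
  have [|n /andP[n1n nn2] nT] := exists_crossing (u := jump_time H ^~ w) (T := T) n12.
    by apply/andP; split; lra.
  move: far; rewrite (tasep_path skel nT) leNgt => /negP; apply.
  have le1 : path_weight t (Y n1 w) k <= path_weight t (Y n w) k.
    by apply: path_weight_le => //; apply: chain_nondecr_le hM _ _; rewrite // ltnW.
  have le2 : path_weight t (Y n w) k <= path_weight t (Y n2 w) k.
    by apply: path_weight_le => //; apply: chain_nondecr_le hM _ _; rewrite //= ltnW.
  by rewrite ltr_norml; apply/andP; split; lra.
apply: le_trans (le_measure P _ _ sub) _; rewrite ?inE.
- exact: measurable_path_weight_far.
- by do 4?apply: measurableU.
have bB n := jump_time_chebyshev mH (tasep_hold_gt0 skel)
  (fun n s => @holds_prob _ _ t01 _ _ _ _ _ _ skel n s) n r0.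
(* The null event [M] is written as a fifth summand to match the union bound. *)
rewrite -[leRHS]adde0 -(chain_nondecr_sure t01 skel n2).
do 3![apply: le_trans (measureU2 _ _ _) _; [by do 3?apply: measurableU| by [] |
  rewrite ?EFinD; apply: leeD; last by [exact: bB|exact: lexx]]].
apply: le_trans (measureU2 _ _ _) _ => //.
by apply: leeD; exact: chain_path_weight.
Qed.

End Sandwich.

(** * Convergence in probability *)

Section Convergence.
Variables (R : realType) (d : R -> measure_display).
Variables (Omega : forall eps : R, measurableType (d eps)).
Variables (P : forall eps : R, probability (Omega eps) R).
Variables (X : forall eps : R, R -> Omega eps -> config).
Arguments X : clear implicits.
Hypothesis HX : forall eps : R, 0 < eps ->
  slowed_tasep (expR (- eps)) (P eps) (X eps).
Variable tau : R.
Hypothesis tau_gt0 : 0 < tau.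

Let parameter01 (eps : R) : 0 < eps -> 0 < expR (- eps) < 1.
Proof. by move=> e0; rewrite expR_gt0 expR_lt1 oppr_lt0. Qed.

Lemma measurable_tasep eps : 0 < eps -> measurable_config (X eps (tau / eps)).
Proof. by move=> e0; apply: (HX e0).1; rewrite divr_ge0 // ltW. Qed.

Lemma chebyshev_bound_expR (eps : R) n k c delta :
  chebyshev_bound (expR (- eps)) n k c delta =
  (binomial_sum ((expR eps - 1) * (1 + (expR eps - 1))) n k ^+ 2 -
   2 * c * binomial_sum (expR eps - 1) n k + c ^+ 2) / delta ^+ 2.
Proof. by rewrite /chebyshev_bound expRN invrK. Qed.

Lemma cvg_path_weight k delta : 0 < delta ->
  (fun eps => P eps [set w | delta <=
     `|path_weight (expR (- eps)) (X eps (tau / eps) w) k - exp_sum tau k.+1|])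
  @ (0 : R)^'+ --> 0%E.
Proof.
move=> d0; pose S (x : R) := exp_sum x k.+1.
have d20 : 0 < delta / 2 by rewrite divr_gt0.
have /cvgrPdist_lt /(_ _ d20) /nbhs_ballP [eta0 /= eta00 near_tau] :=
  @continuous_exp_sum R k.+1 tau.
(* Halving keeps tau - eta positive and both tau - eta and tau + eta within [eta0] of tau. *)
pose eta := Num.min eta0 tau / 2.
have m0 : 0 < Num.min eta0 tau by rewrite lt_min eta00.
have [m1 m2] : Num.min eta0 tau <= eta0 /\ Num.min eta0 tau <= tau.
  by split; rewrite ge_min lexx ?orbT.
have eta_gt0 : 0 < eta by rewrite /eta; lra.
have lo0 : 0 < tau - eta by rewrite /eta; lra.
have hi0 : 0 < tau + eta by rewrite addr_gt0.
have : `|S tau - S (tau - eta)| < delta / 2.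
  by apply: near_tau; rewrite /ball /= ltr_norml /eta; apply/andP; split; lra.
have : `|S tau - S (tau + eta)| < delta / 2.
  by apply: near_tau; rewrite /ball /= ltr_norml /eta; apply/andP; split; lra.
rewrite !ltr_norml => /andP[hi _] /andP[_ lo].
pose n1 x := Num.truncn ((tau - eta) / x).
pose n2 x := Num.truncn ((tau + eta) / x).
have eta20 : 0 < eta / 2 by rewrite divr_gt0.
pose bound x := chebyshev_bound (expR (- x)) (n1 x) k (S (tau - eta)) (delta / 2) +
  chebyshev_bound (expR (- x)) (n2 x) k (S (tau + eta)) (delta / 2) +
  3 * (n1 x)%:R / (eta / 2 / x) ^+ 2 + 3 * (n2 x)%:R / (eta / 2 / x) ^+ 2.
have bound0 : bound x @[x --> (0 : R)^'+] --> (0 : R).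
  rewrite [X in _ --> X](_ : _ = 0 + 0 + 0 + 0); last by rewrite !addr0.
  apply: cvgD; last exact: cvg_jump_bound.
  apply: cvgD; last exact: cvg_jump_bound.
  by apply: cvgD; under eq_fun do rewrite chebyshev_bound_expR;
    exact: cvg_chebyshev_bound.
apply: (squeeze_cvge (f := cst 0%E) (h := fun x => (bound x)%:E)).
- near=> x; have x0 : 0 < x by near: x; exact: nbhs_right_gt.
  rewrite /= measure_ge0 /=.
  have [_ [Y [H skel]]] := HX x0.
  have xeta : x < eta / 2 by near: x; exact: nbhs_right_lt.
  have l1 : (n1 x)%:R <= (tau - eta) / x.
    by rewrite truncn_le divr_ge0 // ltW.
  have l2 : (tau + eta) / x < (n2 x).+1%:R by exact: truncnS_gt.
  (* Of the margin eta / x above tau / x, one half is the allowed deviation of the jump time and the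
     other absorbs the truncation error of [n2], which is below 1. *)
  have one : 1 <= eta / 2 / x by rewrite ler_pdivlMr // mul1r ltW.
  apply: (path_weight_sandwich (parameter01 x0) skel) => //.
  + exact: measurable_tasep.
  + by rewrite divr_gt0.
  + apply: (le_trans (lerD l1 (lexx _))); rewrite -mulrDl ler_pM2r ?invr_gt0 //; lra.
  + have -> : tau / x + eta / 2 / x = (tau + eta) / x - eta / 2 / x by field; rewrite gt_eqF.
    by rewrite -natr1 in l2; lra.
  + by rewrite -/(S _); lra.
  + by rewrite -/(S _); lra.
- exact: cvg_cst.
- by apply/fine_cvgP; split; [near=> x|].
Unshelve. all: by end_near. Qed.

Lemma ln_exprz_expR (u : R) (z : int) : ln (expR u ^ z) = z%:~R * u.
Proof.
case: z => n; first by rewrite -exprnP -expRM_natl expRK.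
by rewrite NegzE -exprnN -expRM_natl -expRN expRK mulrNz mulNr.
Qed.

(** The quotient v_k / v_(k+1) is the weight u_(k+1) = exp (- eps (x_(k+1) + k + 1)); take
    logarithms. *)
Lemma particle_path_weight (eps : R) x k : 0 < eps ->
  eps * (particle x k.+1)%:~R =
  ln (path_weight (expR (- eps)) x k.+1) - ln (path_weight (expR (- eps)) x k) -
  eps * k.+1%:R.
Proof.
move=> e0; have t01 := parameter01 e0.
rewrite -(path_weightS t01 x k) lnM ?posrE ?path_weight_gt0 ?weight_gt0 //.
by rewrite [ln (weight _ _ _)]ln_exprz_expR /particle /= intrD; ring.
Qed.

Lemma ln_near (s delta : R) : 0 < s -> 0 < delta -> exists2 e, 0 < e &
  forall v, `|v - s| < e -> `|ln v - ln s| < delta.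
Proof.
move=> s0 d0.
have /cvgrPdist_lt /(_ _ d0) /nbhs_ballP [e /= e0 near_s] := continuous_ln s0.
exists e => // v vs; rewrite distrC; apply: near_s.
by rewrite /ball /= distrC.
Qed.

Lemma cvg_particle k : cvg_in_probability (0 : R)^'+ P
  (fun eps w => eps * (particle (X eps (tau / eps) w) k.+1)%:~R)
  (ln (exp_sum tau k.+2) - ln (exp_sum tau k.+1)).
Proof.
(* One third of [delta] for each logarithm and one for the deterministic shift [eps * k.+1%:R]. *)
move=> delta d0; have d30 : 0 < delta / 3 by rewrite divr_gt0.
have [e1 e10 near1] := ln_near (exp_sum_gt0 k.+1 tau_gt0) d30.
have [e2 e20 near2] := ln_near (exp_sum_gt0 k tau_gt0) d30.
have c1 := @cvg_path_weight k.+1 _ e10.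
have c2 := @cvg_path_weight k _ e20.
apply: (squeeze_cvge (f := cst 0%E) _ _ (h := fun eps =>
  (P eps [set w | (e1 <= `|path_weight (expR (- eps)) (X eps (tau / eps) w) k.+1 -
      exp_sum tau k.+2|)%R] +
   P eps [set w | (e2 <= `|path_weight (expR (- eps)) (X eps (tau / eps) w) k -
      exp_sum tau k.+1|)%R])%E)).
- near=> eps; have e0 : 0 < eps by near: eps; exact: nbhs_right_gt.
  rewrite /= measure_ge0 /=.
  have small : eps < delta / 3 / k.+1%:R by near: eps; apply: nbhs_right_lt; rewrite divr_gt0.
  rewrite ltr_pdivlMr // in small.
  have mX := measurable_tasep e0.
  apply: le_trans (measureU2 _ _ _); [|exact: measurable_path_weight_far..].
  apply: le_measure; rewrite ?inE.
  + rewrite (_ : mkset _ = (fun w => delta < `|eps *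
      (config_pos (X eps (tau / eps) w) k)%:~R -
      (ln (exp_sum tau k.+2) - ln (exp_sum tau k.+1))|) @^-1` [set true]) //.
    rewrite -[X in measurable X]setTI; apply: measurable_fun_ltr => //.
    apply: measurableT_comp => //; apply: measurable_funB => //.
    by apply: measurable_funM => //; exact: measurable_fun_config_pos.
  + by apply: measurableU; exact: measurable_path_weight_far.
  move=> w /=; rewrite particle_path_weight // => far.
  apply: contrapT => /not_orP[/negP + /negP +]; rewrite -!ltNge => /near1 b1 /near2 b2.
  move: far; rewrite ltNge => /negP; apply.
  have ek : 0 < eps * k.+1%:R by rewrite mulr_gt0.
  move: b1 b2; rewrite !ltr_norml ler_norml => /andP[? ?] /andP[? ?].
  by apply/andP; split; lra.
- exact: cvg_cst.
- by rewrite -(adde0 0%E); apply: cvgeD.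
Unshelve. all: by end_near. Qed.

End Convergence.

Unset Implicit Arguments.
Set Strict Implicit.

Theorem theorem1p1 (R : realType)
  (d : R -> measure_display) (Omega : forall eps : R, measurableType (d eps))
  (P : forall eps : R, probability (Omega eps) R)
  (X : forall eps : R, R -> Omega eps -> config)
  (HX : forall eps : R, 0 < eps ->
          slowed_tasep (expR (- eps)) (P eps) (X eps))
  (tau : R) (tau_gt0 : 0 < tau) (k : nat) (k_gt0 : (0 < k)%N) :
  cvg_in_probability (0 : R)^'+ P
    (fun eps w => eps * (particle (X eps (tau / eps) w) k)%:~R)
    (ln (\sum_(0 <= j < k.+1) tau ^+ j / j`!%:R) -
     ln (\sum_(0 <= j < k) tau ^+ j / j`!%:R)).
Proof.
case: k k_gt0 => // k _.
exact: cvg_particle.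
Qed.
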